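(* Let $N\ge 3$, $R_0>0$, $\Omega=\mathbb{R}^N\setminus B_{R_0}$, and let $b,c\in C(\Omega)$ be real-valued with $c\ge 0$ in $\Omega$ and with $c(x)-\frac{b(x)^2}{4}>0$ for all $|x|$ sufficiently large. Put $\beta:=\frac{N-2}{2}$. If for some $\gamma>1$ $$\sup_{R>2R_0}\ \frac{\displaystyle\inf_{R<|x|<\gamma R}|x|^2\Big(c(x)-\frac{b(x)^2}{4}\Big)}{\displaystyle\sup_{\frac R2<|x|<2\gamma R}\Big(1+\frac{2|x|\,|b(x)|}{N-2}\Big)}\ >\ \frac{\beta^2\ln 2+4\beta+6}{\ln\gamma}+\beta^2,$$ then the equation $-\Delta u+b(x)|\nabla u|=c(x)u$ has no positive supersolution in $\Omega$. In particular, there is no positive supersolution in $\Omega$ if $$\frac{\displaystyle\liminf_{|x|\to\infty}|x|^2\Big(c(x)-\frac{b(x)^2}{4}\Big)}{\displaystyle\limsup_{|x|\to\infty}\Big(1+\frac{2|x|\,|b(x)|}{N-2}\Big)}\ >\ \frac{(N-2)^2}{4}.$$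
   Context: A positive supersolution of $-\Delta u+b(x)|\nabla u|=c(x)u$ in $\Omega$ is a function $u\in C^2(\Omega)$ with $u>0$ in $\Omega$ and $-\Delta u+b(x)|\nabla u|\ge c(x)u$ pointwise in $\Omega$. Here $B_{R_0}$ is the (closed) ball of radius $R_0$ centered at the origin, so $\Omega=\{x\in\mathbb{R}^N:|x|>R_0\}$. In the last condition the denominator is understood to be finite, while the numerator may be $+\infty$. *)

(* Defs.v *)
From HB Require Import structures.
From mathcomp Require Import all_boot all_order all_algebra.
From mathcomp Require Import all_classical all_reals all_analysis.
Set Implicit Arguments.
Unset Strict Implicit.
Unset Printing Implicit Defensive.
Import Order.TTheory GRing.Theory Num.Theory.
Import numFieldNormedType.Exports.
Local Open Scope classical_set_scope.
Local Open Scope ring_scope.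

(* The canonical norm of ['rV[R]_N] is the sup norm, so the Euclidean norm is
   defined separately; both induce the same topology. *)
Definition enorm (R : realType) (N : nat) (x : 'rV[R]_N) : R :=
  Num.sqrt (\sum_(i < N) x ord0 i ^+ 2).

Definition exterior (R : realType) (N : nat) (r : R) : set 'rV[R]_N :=
  [set x | r < enorm x].

Definition annulus (R : realType) (N : nat) (r1 r2 : R) : set 'rV[R]_N :=
  [set x | r1 < enorm x < r2].

Definition at_infinity (R : realType) (N : nat) : set_system 'rV[R]_N :=
  filter_from [set: R] (@exterior R N).
Arguments at_infinity : clear implicits.

Definition partial (R : realType) (N : nat) (i : 'I_N) (f : 'rV[R]_N -> R) :
    'rV[R]_N -> R :=
  fun x => 'D_(delta_mx ord0 i) f x.

Definition gradient (R : realType) (N : nat) (f : 'rV[R]_N -> R)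
    (x : 'rV[R]_N) : 'rV[R]_N :=
  \row_i partial i f x.

Definition laplacian (R : realType) (N : nat) (f : 'rV[R]_N -> R)
    (x : 'rV[R]_N) : R :=
  \sum_(i < N) partial i (partial i f) x.

(* [C1_on A] and [C2_on A] are meant for open [A]: they then depend only on
   the values of [f] on [A]. *)
Definition C1_on (R : realType) (N : nat) (A : set 'rV[R]_N)
    (f : 'rV[R]_N -> R) : Prop :=
  [/\ {within A, continuous f},
      forall (i : 'I_N) x, A x -> derivable f x (delta_mx ord0 i)
    & forall i : 'I_N, {within A, continuous (partial i f)}].

Definition C2_on (R : realType) (N : nat) (A : set 'rV[R]_N)
    (f : 'rV[R]_N -> R) : Prop :=
  C1_on A f /\ forall i : 'I_N, C1_on A (partial i f).

(* Positive supersolution of -Delta u + b(x) |grad u| = c(x) u in [A]. *)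
Definition positive_supersolution (R : realType) (N : nat) (A : set 'rV[R]_N)
    (b c u : 'rV[R]_N -> R) : Prop :=
  [/\ C2_on A u,
      forall x, A x -> 0 < u x
    & forall x, A x ->
        c x * u x <= - laplacian u x + b x * enorm (gradient u x)].

Definition scaled_potential (R : realType) (N : nat) (b c : 'rV[R]_N -> R)
    (x : 'rV[R]_N) : R :=
  enorm x ^+ 2 * (c x - b x ^+ 2 / 4).

Definition drift_weight (R : realType) (N : nat) (b : 'rV[R]_N -> R)
    (x : 'rV[R]_N) : R :=
  1 + 2 * enorm x * `|b x| / (N%:R - 2).

(* Main.v *)
(* A positive supersolution u is touched from below by an explicit radial
   barrier.  Put beta = (N-2)/2, s = ln |x|, and let p be the midpoint of
   [ln r, ln (gamma r)], h = (ln gamma)/2.  The barrier is the Gaussian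
   exp (- kappa (s - p)^2 / 2) for |s - p| <= h, continued on both sides by
   multiples of exp (k (h + ln 2 - |s - p|)) - 1, which vanish at
   |s - p| = h + ln 2.  At a maximum point of barrier / u over the closed
   annulus r/2 <= |x| <= 2 gamma r, first and second derivatives are compared
   along the coordinate lines.
   - For |s - p| > h the barrier is a strict subsolution as soon as c >= 0 and
     |x| |b| <= beta (D - 1).
   - For |s - p| < h, completing the square in the drift term bounds
     |x|^2 (c - b^2/4) by kappa + beta^2 D.
   - At |s - p| = h the kink of the barrier is convex, so that no
     differentiable function can touch it from above.
   With k = beta (D + 1) + 1 and kappa = (k + 2) / h, the assumption gives
   kappa + beta^2 D < inf |x|^2 (c - b^2/4), which excludes the middle case. *)
Require Import Defs.
From HB Require Import structures.
From mathcomp Require Import all_boot all_order all_algebra.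
From mathcomp Require Import all_classical all_reals all_analysis.
From mathcomp Require Import ring lra.
Set Implicit Arguments.
Unset Strict Implicit.
Unset Printing Implicit Defensive.
Import Order.TTheory GRing.Theory Num.Theory.
Import numFieldNormedType.Exports.
Local Open Scope classical_set_scope.
Local Open Scope ring_scope.

(** * Derivative tests in one variable *)

Lemma is_derive1_sign (R : realType) (f : R -> R) (x d : R) :
  is_derive x 1 f d -> d != 0 ->
  \forall t \near x, t != x -> 0 < (f t - f x) * (d * (t - x)).
Proof.
move=> /is_derive1_caratheodory [h [fE hC hx]] d0.
have hd : \forall t \near x, 0 < h t * d.
  have : h t * d @[t --> x] --> d * d.
    by rewrite -hx; apply: cvgM; [exact: hC|exact: cvg_cst].
  by move=> /cvgr_gt; apply; rewrite -expr2 exprn_even_gt0.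
apply: filterS hd => t hd tx; rewrite fE.
rewrite (_ : _ * _ = h t * d * (t - x) ^+ 2); last by ring.
by rewrite mulr_gt0// exprn_even_gt0//= subr_eq0.
Qed.

(** The sign of [v] selects the side on which [x] is a minimum, so that left and right minima are
    treated at once. Were [v * d < 0], the increments on that side would be negative. *)
Lemma is_derive1_one_sided (R : realType) (f : R -> R) (x d v : R) :
  is_derive x 1 f d ->
  (\forall t \near x, 0 < v * (t - x) -> f x <= f t) -> 0 <= v * d.
Proof.
move=> df fmin; rewrite leNgt; apply/negP => vd0.
have [v0 d0] : v != 0 /\ d != 0.
  by split; apply: contraTneq vd0 => ->; rewrite ?mul0r ?mulr0 ltxx.
have : \forall t \near x, (0 < v * (t - x) -> f x <= f t) /\
    (t != x -> 0 < (f t - f x) * (d * (t - x))).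
  by apply: filterI => //; exact: is_derive1_sign.
move=> /nbhs_ballP[e /= e0 he].
pose t := x + Num.sg v * (e / 2).
have tx : t - x = Num.sg v * (e / 2) by rewrite /t; ring.
have tE : `|t - x| = e / 2.
  by rewrite tx normrM normr_sg v0 mul1r gtr0_norm// divr_gt0.
have tB : ball x e t by rewrite /ball/= distrC tE; lra.
have [h1 h2] := he _ tB.
have /h2 : t != x by rewrite -subr_eq0 -normr_gt0 tE divr_gt0.
have /h1 ft : 0 < v * (t - x).
  by rewrite tx mulrA (mulrC v) -normrEsg mulr_gt0 ?normr_gt0 ?divr_gt0.
apply/negP; rewrite -leNgt mulr_ge0_le0 ?subr_ge0//.
have : d * (t - x) * v ^+ 2 < 0.
  rewrite (_ : _ * _ = v * d * (v * (t - x))); last by ring.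
  by rewrite nmulr_rlt0// tx mulrA (mulrC v) -normrEsg mulr_gt0 ?normr_gt0 ?divr_gt0.
by rewrite pmulr_llt0 ?exprn_even_gt0// => /ltW.
Qed.

(** Were [d < 0], then [f'], which vanishes at [x], would be negative just to the right of [x], and
    by the mean value theorem [f] would drop below [f x]. The second derivative is wanted at [x]
    alone, so continuity of second derivatives never enters. *)
Lemma is_derive1_local_min (R : realType) (f f' : R -> R) (x d : R) :
  (\forall t \near x, is_derive (t : R) (1 : R) f (f' t)) -> is_derive x 1 f' d ->
  (\forall t \near x, f x <= f t) -> f' x = 0 /\ 0 <= d.
Proof.
move=> df df' fmin.
have f'0 : f' x = 0.
  have one v : 0 <= v * f' x.
    apply: (is_derive1_one_sided (nbhs_singleton df)).
    by apply: filterS fmin => t ft _.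
  by apply/le_anti; rewrite -oppr_ge0 -mulN1r one/= -[X in _ <= X]mul1r one.
split=> //; rewrite leNgt; apply/negP => d0.
have d0' : d != 0 by rewrite lt_eqF.
have : \forall t \near x, (f x <= f t /\ is_derive t (1 : R) f (f' t)) /\
    (t != x -> 0 < (f' t - f' x) * (d * (t - x))).
  by apply: filterI; [exact: filterI|exact: is_derive1_sign].
move=> /nbhs_ballP[e /= e0 he].
pose b := x + e / 2.
have xb : x < b by rewrite ltrDl divr_gt0.
have hB t : x <= t -> t <= b -> ball x e t.
  move=> xt tb; rewrite /ball/= distrC ger0_norm ?subr_ge0//.
  by move: tb; rewrite /b; lra.
have [] := @MVT R f f' x b xb.
- move=> t; rewrite in_itv/= => /andP[xt tb].
  by have [[]] := he t (hB _ (ltW xt) (ltW tb)).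
- apply: derivable_within_continuous => t; rewrite in_itv/= => /andP[xt tb].
  by have [[_ []]] := he t (hB _ xt tb).
- move=> c; rewrite in_itv/= => /andP[xc cb] E.
  have [_ /(_ _)] := he c (hB _ (ltW xc) (ltW cb)).
  rewrite gt_eqF// f'0 subr0 => /(_ isT).
  rewrite mulrA pmulr_lgt0 ?subr_gt0// nmulr_lgt0// => f'c.
  have [[fb _] _] := he b (hB _ (ltW xb) (lexx _)).
  have : f b - f x < 0 by rewrite E pmulr_llt0 ?subr_gt0.
  by rewrite subr_lt0 ltNge fb.
Qed.

(** * The Euclidean norm along coordinate lines *)

Lemma is_derive_line (R : realType) (N : nat) (u : 'rV[R]_N -> R)
    (x e : 'rV[R]_N) (t : R) :
  derivable u (x + t *: e) e ->
  is_derive t 1 (fun s : R => u (x + s *: e)) ('D_e u (x + t *: e)).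
Proof.
move=> du.
have E : (fun h : R => h^-1 *: (((fun s : R => u (x + s *: e)) \o shift t) (h *: 1)
      - u (x + t *: e))) =
  (fun h : R => h^-1 *: ((u \o shift (x + t *: e)) (h *: e) - u (x + t *: e))).
  apply/funext => h /=; congr (_ *: (u _ - _)).
  by rewrite [h *: 1]mulr1 scalerDl addrCA addrA addrC addrA.
by split; [rewrite /derivable E|rewrite /derive E].
Qed.

Lemma enorm_ge0 (R : realType) (N : nat) (x : 'rV[R]_N) : 0 <= enorm x.
Proof. exact: sqrtr_ge0. Qed.

Lemma sqr_enorm (R : realType) (N : nat) (x : 'rV[R]_N) :
  enorm x ^+ 2 = \sum_(i < N) x ord0 i ^+ 2.
Proof. by rewrite sqr_sqrtr// sumr_ge0// => i _; rewrite sqr_ge0. Qed.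

Lemma sqr_enorm_line (R : realType) (N : nat) (x : 'rV[R]_N) (i : 'I_N)
    (t : R) :
  enorm (x + t *: delta_mx ord0 i) ^+ 2 =
  enorm x ^+ 2 + 2 * x ord0 i * t + t ^+ 2.
Proof.
rewrite !sqr_enorm (bigD1 i)//= [in RHS](bigD1 i)//= !mxE !eqxx mulr1.
rewrite (eq_bigr (fun j : 'I_N => x ord0 j ^+ 2)); first by ring.
by move=> j ji; rewrite !mxE (negbTE ji) andbF mulr0 addr0.
Qed.

Lemma enorm0_line (R : realType) (N : nat) (i : 'I_N) (t : R) : 0 <= t ->
  enorm (t *: delta_mx ord0 i : 'rV[R]_N) = t.
Proof.
move=> t0; apply/eqP; rewrite -(@eqrXn2 _ 2) ?enorm_ge0//.
rewrite -[X in enorm X]add0r sqr_enorm_line mxE sqr_enorm big1.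
  by rewrite mulr0 mul0r !add0r.
by move=> j _; rewrite mxE expr0n.
Qed.

Lemma continuous_enorm (R : realType) (N : nat) :
  continuous (@enorm R N).
Proof.
have sum_cont : continuous
    (\sum_(i < N) (fun y : 'rV[R]_N => y ord0 i ^+ 2) : 'rV[R]_N -> R).
  elim/big_ind: _ => [|f g cf cg|i _] x.
  - exact: cst_continuous.
  - exact: (continuousD (cf x) (cg x)).
  - have ci := @coord_continuous R 1 N ord0 i x.
    exact: (continuousM ci ci).
move=> x.
have -> : @enorm R N =
    Num.sqrt \o (\sum_(i < N) (fun y : 'rV[R]_N => y ord0 i ^+ 2)).
  by apply/funext => y; rewrite /= fct_sumE.
by apply: continuous_comp; [exact: sum_cont|exact: sqrt_continuous].
Qed.

Lemma cvg_line (R : realType) (N : nat) (x e : 'rV[R]_N) :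
  x + t *: e @[t --> (0 : R)] --> x.
Proof.
rewrite -[X in _ --> X]addr0 -[X in _ + X](scale0r e).
by apply: cvgD; [exact: cvg_cst|apply: cvgZr_tmp; exact: cvg_id].
Qed.

Lemma is_derive_sqr_enorm (R : realType) (N : nat) (x : 'rV[R]_N) (i : 'I_N)
    (t : R) :
  is_derive t 1 (fun s : R => enorm (x + s *: delta_mx ord0 i) ^+ 2)
    (2 * (x ord0 i + t)).
Proof.
apply/is_derive1_caratheodory; exists (fun z => 2 * x ord0 i + (z + t)); split.
- by move=> z; rewrite !sqr_enorm_line; ring.
- by apply: cvgD; [exact: cvg_cst|apply: cvgD; [exact: cvg_id|exact: cvg_cst]].
- by ring.
Qed.

Lemma is_derive_ln_enorm (R : realType) (N : nat) (x : 'rV[R]_N) (i : 'I_N)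
    (t : R) : 0 < enorm (x + t *: delta_mx ord0 i) ->
  is_derive t 1 (fun s : R => ln (enorm (x + s *: delta_mx ord0 i)))
    ((x ord0 i + t) / enorm (x + t *: delta_mx ord0 i) ^+ 2).
Proof.
set n := fun s : R => enorm (x + s *: delta_mx ord0 i) => h.
(* The squared norm is quadratic in [s]; it is differentiated first, and the square root
   afterwards. *)
have nE : n = Num.sqrt \o (fun s => n s ^+ 2).
  by apply/funext => s /=; rewrite sqrtr_sqr ger0_norm// enorm_ge0.
have q0 : 0 < n t ^+ 2 by rewrite exprn_gt0.
have := @is_derive1_comp R Num.sqrt (fun s => n s ^+ 2) t _ _
  (is_derive1_sqrt q0) (is_derive_sqr_enorm x i t).
rewrite -nE sqrtr_sqr ger0_norm ?enorm_ge0// => dn.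
apply: is_derive_eq (@is_derive1_comp R (@ln R) n t _ _ (is_derive1_ln h) dn) _.
by rewrite -/(n t); field; rewrite gt_eqF.
Qed.

(** * Radial functions touching from below *)

(** On each coordinate line through [x], the difference of [m * u] and the radial function has a
    local minimum at [t = 0]. The first-order conditions determine the gradient, and the sum of the
    second-order ones bounds the Laplacian. In the variable [ln |x|], [|x|^2] times the Laplacian of
    a radial function is [phi'' + (N - 2) phi']. *)
Lemma radial_touching (R : realType) (N : nat) (u : 'rV[R]_N -> R)
    (x : 'rV[R]_N) (m : R) (phi phi1 phi2 : R -> R) :
  0 < enorm x ->
  (forall s : R, is_derive s (1 : R) phi (phi1 s)) ->
  (forall s : R, is_derive s (1 : R) phi1 (phi2 s)) ->
  (forall i, \forall t \near (0 : R), derivable u (x + t *: delta_mx ord0 i)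
     (delta_mx ord0 i)) ->
  (forall i, derivable (partial i u) x (delta_mx ord0 i)) ->
  (forall i, \forall t \near (0 : R), phi (ln (enorm (x + t *: delta_mx ord0 i)))
     <= m * u (x + t *: delta_mx ord0 i)) ->
  phi (ln (enorm x)) = m * u x ->
  enorm x * (`|m| * enorm (gradient u x)) = `|phi1 (ln (enorm x))| /\
  phi2 (ln (enorm x)) + (N%:R - 2) * phi1 (ln (enorm x)) <=
    enorm x ^+ 2 * (m * laplacian u x).
Proof.
move=> x0 dphi dphi1 du ddu le_phi eq_phi.
set r := enorm x in x0 *; set s := ln r in eq_phi *.
have line0 i : x + (0 : R) *: delta_mx ord0 i = x by rewrite scale0r addr0.
have key i : m * partial i u x = phi1 s * (x ord0 i / r ^+ 2) /\
    phi2 s * (x ord0 i / r ^+ 2) ^+ 2 +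
    phi1 s * ((r ^+ 2)^-1 - 2 * x ord0 i ^+ 2 / r ^+ 4)
      <= m * partial i (partial i u) x.
  pose e : 'rV[R]_N := delta_mx ord0 i.
  pose l (t : R) := ln (enorm (x + t *: e)).
  pose l' (t : R) := (x ord0 i + t) / enorm (x + t *: e) ^+ 2.
  pose f (t : R) := m * u (x + t *: e) - phi (l t).
  pose f' (t : R) := m * partial i u (x + t *: e) - phi1 (l t) * l' t.
  have pos_near : \forall t \near (0 : R), 0 < enorm (x + t *: e).
    have : enorm (x + t *: e) @[t --> (0 : R)] --> enorm x.
      by apply: continuous_cvg; [exact: continuous_enorm|exact: cvg_line].
    by move=> /cvgr_gt; apply.
  have [] := @is_derive1_local_min R f f' 0 (m * partial i (partial i u) x -
     (phi2 s * (x ord0 i / r ^+ 2) ^+ 2 +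
    phi1 s * ((r ^+ 2)^-1 - 2 * x ord0 i ^+ 2 / r ^+ 4))).
  - near=> t.
    have h1 : is_derive t (1 : R) (fun t : R => u (x + t *: e))
        (partial i u (x + t *: e)).
      by apply: is_derive_line; near: t; exact: du.
    have h2 : is_derive t (1 : R) l (l' t).
      by apply: is_derive_ln_enorm; near: t.
    have h3 := @is_derive1_comp R phi l t _ _ (dphi _) h2.
    exact: (is_deriveB (is_deriveZ m h1) h3).
  - have h1 : is_derive (0 : R) (1 : R) (fun t : R => partial i u (x + t *: e))
        (partial i (partial i u) x).
      by rewrite -{2}(line0 i); apply: is_derive_line; rewrite line0.
    have h2 : is_derive (0 : R) (1 : R) l (l' 0).
      by apply: is_derive_ln_enorm; rewrite line0.
    have h3 := @is_derive1_comp R phi1 l 0 _ _ (dphi1 _) h2.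
    have r20 : enorm (x + (0 : R) *: e) ^+ 2 != 0.
      by rewrite line0 expf_neq0// gt_eqF.
    have h4 := @is_deriveV R (fun s : R => enorm (x + s *: e) ^+ 2) 0 _ 1 r20
      (is_derive_sqr_enorm x i 0).
    have h5 : is_derive (0 : R) (1 : R) (fun t => x ord0 i + t) 1.
      apply/is_derive1_caratheodory; exists (cst 1); split=> //.
        by move=> z; rewrite mul1r; ring.
      exact: cvg_cst.
    have l'0 : l' 0 = x ord0 i / r ^+ 2 by rewrite /l' addr0 line0.
    have h6 : is_derive (0 : R) (1 : R) l' _ := is_deriveM h5 h4.
    have h7 := is_deriveB (is_deriveZ m h1) (is_deriveM h3 h6).
    apply: is_derive_eq h7 _.
    rewrite l'0 /= /l line0 -/r -/s addr0.
    by rewrite /GRing.scale/=; field; rewrite gt_eqF.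
  - near=> t.
    rewrite /f /l {1}/e line0 eq_phi subrr subr_ge0.
    by near: t; exact: le_phi.
  - rewrite /f' /l' /l /e line0 addr0 -/r -/s => /eqP; rewrite subr_eq0 => /eqP ->.
    by rewrite subr_ge0.
have sq : \sum_(i < N) x ord0 i ^+ 2 = r ^+ 2 by rewrite -sqr_enorm.
split.
  apply/eqP; rewrite -(@eqrXn2 _ 2) ?mulr_ge0 ?enorm_ge0//.
  rewrite !exprMn !real_normK ?num_real// (sqr_enorm (gradient u x)) mulr_sumr.
  under eq_bigr do rewrite mxE -exprMn (key _).1 exprMn expr_div_n.
  rewrite -mulr_sumr -mulr_suml sq -exprM; apply/eqP; field.
  by rewrite gt_eqF.
rewrite /laplacian !mulr_sumr.
apply: (@le_trans _ _ (\sum_(i < N) r ^+ 2 * (phi2 s * (x ord0 i / r ^+ 2) ^+ 2 +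
    phi1 s * ((r ^+ 2)^-1 - 2 * x ord0 i ^+ 2 / r ^+ 4)))).
  rewrite le_eqVlt; apply/orP; left; apply/eqP.
  (* Since the [x_i ^ 2] sum to [r ^ 2], the total is [phi2 - 2 phi1 + N phi1]. *)
  transitivity (\sum_(i < N) ((phi2 s - 2 * phi1 s) / r ^+ 2 * x ord0 i ^+ 2 + phi1 s)).
    rewrite big_split/= -mulr_sumr sq sumr_const card_ord -mulr_natl; field.
    by rewrite gt_eqF.
  apply: eq_bigr => i _; field.
  by rewrite gt_eqF.
by apply: ler_sum => i _; rewrite ler_pM2l ?exprn_gt0//; exact: (key i).2.
Unshelve. all: by end_near. Qed.

Lemma near_line (R : realType) (N : nat) (x e : 'rV[R]_N) (a b : R) :
  0 < enorm x -> a < ln (enorm x) < b ->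
  \forall t \near (0 : R), a < ln (enorm (x + t *: e)) < b.
Proof.
move=> x0 /andP[ax xb].
have cvl : ln (enorm (x + t *: e)) @[t --> (0 : R)] --> ln (enorm x).
  apply: continuous_cvg; first exact: continuous_ln.
  by apply: continuous_cvg; [exact: continuous_enorm|exact: cvg_line].
have al : \forall t \near (0 : R), a < ln (enorm (x + t *: e)).
  by move/cvgr_gt: cvl; apply.
have lb : \forall t \near (0 : R), ln (enorm (x + t *: e)) < b.
  by move/cvgr_lt: cvl; apply.
by apply: filterS2 al lb => t -> ->.
Qed.

Lemma open_exterior (R : realType) (N : nat) (r : R) :
  open (exterior r : set 'rV[R]_N).
Proof.
apply: (@open_comp _ _ (@enorm R N) [set y | r < y]); last exact: open_gt.
by move=> x _; exact: continuous_enorm.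
Qed.

Lemma near_line_exterior (R : realType) (N : nat) (x e : 'rV[R]_N) (r : R) :
  exterior r x -> \forall t \near (0 : R), exterior r (x + t *: e).
Proof.
move=> xr; have rx : nbhs x (exterior r).
  by apply: open_nbhs_nbhs; split=> //; exact: open_exterior.
exact: (@cvg_line _ _ x e _ rx).
Qed.

(** The touching relations turn the supersolution inequality, multiplied by [m |x|^2], into a
    differential inequality for [phi] alone; the barrier pieces are designed to violate it. Only
    [|b|] survives because the gradient is known through its norm. *)
Lemma supersolution_touching (R : realType) (N : nat) (r : R)
    (b c u : 'rV[R]_N -> R) (x : 'rV[R]_N) (m : R) (phi phi1 phi2 : R -> R) :
  positive_supersolution (exterior r) b c u ->
  exterior r x -> 0 < enorm x -> 0 < m ->
  (forall s : R, is_derive s (1 : R) phi (phi1 s)) ->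
  (forall s : R, is_derive s (1 : R) phi1 (phi2 s)) ->
  (forall i, \forall t \near (0 : R), phi (ln (enorm (x + t *: delta_mx ord0 i)))
     <= m * u (x + t *: delta_mx ord0 i)) ->
  phi (ln (enorm x)) = m * u x ->
  enorm x ^+ 2 * c x * phi (ln (enorm x)) <=
    enorm x * `|b x| * `|phi1 (ln (enorm x))| -
    (phi2 (ln (enorm x)) + (N%:R - 2) * phi1 (ln (enorm x))).
Proof.
move=> [[[_ du _] ddu] u0 usup] xr x0 m0 dphi dphi1 le_phi eq_phi.
have [] := radial_touching x0 dphi dphi1 _ _ le_phi eq_phi.
- move=> i; near=> t; apply: du; near: t; exact: near_line_exterior.
- by move=> i; have [_ + _] := ddu i; apply.
rewrite gtr0_norm// => grad_eq lap_le.
rewrite eq_phi -grad_eq lerBrDr (le_trans (lerD (lexx _) lap_le))//.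
have mr0 : 0 <= m * enorm x ^+ 2 by rewrite mulr_ge0 ?ltW// exprn_gt0.
have := ler_wpM2l mr0 (usup x xr).
have : b x * enorm (gradient u x) <= `|b x| * enorm (gradient u x).
  by rewrite ler_wpM2r ?enorm_ge0// ler_norm.
move=> /(ler_wpM2l mr0).
move: (laplacian u x) (enorm (gradient u x)) (enorm x) (u x) (`|b x|) => *.
lra.
Unshelve. all: by end_near. Qed.

(** Here [phi] is the inner and [psi] the outer branch. The derivative of [m * u] along a line
    crossing the sphere transversally is squeezed between the two one-sided slopes. *)
Lemma radial_kink (R : realType) (N : nat) (u : 'rV[R]_N -> R) (x : 'rV[R]_N)
    (m : R) (phi psi : R -> R) (phi1 psi1 : R) :
  0 < enorm x ->
  (forall i, derivable u x (delta_mx ord0 i)) ->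
  is_derive (ln (enorm x)) 1 phi phi1 -> is_derive (ln (enorm x)) 1 psi psi1 ->
  phi (ln (enorm x)) = m * u x -> psi (ln (enorm x)) = m * u x ->
  (forall i, \forall t \near (0 : R),
    (ln (enorm (x + t *: delta_mx ord0 i)) < ln (enorm x) ->
     phi (ln (enorm (x + t *: delta_mx ord0 i)))
       <= m * u (x + t *: delta_mx ord0 i)) /\
    (ln (enorm x) < ln (enorm (x + t *: delta_mx ord0 i)) ->
     psi (ln (enorm (x + t *: delta_mx ord0 i)))
       <= m * u (x + t *: delta_mx ord0 i))) ->
  psi1 <= phi1.
Proof.
move=> x0 du dphi dpsi phiE psiE le_phipsi.
(* A coordinate with [x_i != 0] makes [ln |x + t e_i|] strictly monotone at first order, so that
   [t < 0] and [t > 0] lie on different sides of the sphere. *)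
have [i xi0] : exists i, x ord0 i != 0.
  apply: contrapT => /forallNP xz.
  have : enorm x ^+ 2 = 0.
    rewrite sqr_enorm big1// => i _.
    by have /negP/negPn/eqP -> := xz i; rewrite expr0n.
  by move/eqP; rewrite gt_eqF// exprn_gt0.
pose e : 'rV[R]_N := delta_mx ord0 i.
pose l (t : R) := ln (enorm (x + t *: e)).
have line0 : x + (0 : R) *: e = x by rewrite scale0r addr0.
have l0 : l 0 = ln (enorm x) by rewrite /l line0.
pose d := x ord0 i / enorm x ^+ 2.
have d0 : d != 0 by rewrite mulf_neq0// invr_eq0 expf_neq0// gt_eqF.
have dl : is_derive (0 : R) (1 : R) l d.
  have h : 0 < enorm (x + (0 : R) *: delta_mx ord0 i) by rewrite line0.
  by have := is_derive_ln_enorm h; rewrite addr0 line0.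
have dg : is_derive (0 : R) (1 : R) (fun t : R => u (x + t *: e)) (partial i u x).
  by rewrite -{2}line0; apply: is_derive_line; rewrite line0; exact: du.
have near_sign := is_derive1_sign dl d0.
(* The choice [v = - d] selects the inner side and [v = d] the outer one. Adding the two
   inequalities cancels the derivative of [u]. *)
have H (chi : R -> R) (chi1 v : R) : is_derive (ln (enorm x)) 1 chi chi1 ->
    chi (ln (enorm x)) = m * u x ->
    (\forall t \near (0 : R), 0 < v * (t - 0) -> chi (l t) <= m * u (x + t *: e)) ->
    0 <= v * (m * partial i u x - chi1 * d).
  rewrite -l0 => dchi chiE chi_le.
  have dk := is_deriveB (is_deriveZ m dg) (@is_derive1_comp R chi l 0 _ _ dchi dl).
  apply: (is_derive1_one_sided dk).
  apply: filterS chi_le => t h /h ?.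
  by rewrite !fctE/= line0 chiE subrr subr_ge0.
have h1 : 0 <= - d * (m * partial i u x - phi1 * d).
  apply: (H phi) => //; near=> t => dt.
  have t0 : t != 0 by apply: contraTneq dt => ->; rewrite subrr mulr0 ltxx.
  have [+ _] :
    (l t < ln (enorm x) -> phi (l t) <= m * u (x + t *: e)) /\
    (ln (enorm x) < l t -> psi (l t) <= m * u (x + t *: e)).
    by near: t; exact: le_phipsi.
  apply.
  have : 0 < (l t - l 0) * (d * (t - 0)).
    by move: t0; near: t.
  move: dt; rewrite mulNr oppr_gt0 => dt; rewrite nmulr_lgt0// l0 subr_lt0//.
have h2 : 0 <= d * (m * partial i u x - psi1 * d).
  apply: (H psi) => //; near=> t => dt.
  have t0 : t != 0 by apply: contraTneq dt => ->; rewrite subrr mulr0 ltxx.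
  have [_ +] :
    (l t < ln (enorm x) -> phi (l t) <= m * u (x + t *: e)) /\
    (ln (enorm x) < l t -> psi (l t) <= m * u (x + t *: e)).
    by near: t; exact: le_phipsi.
  apply.
  have : 0 < (l t - l 0) * (d * (t - 0)).
    by move: t0; near: t.
  by rewrite pmulr_lgt0// l0 subr_gt0.
have : 0 <= d ^+ 2 * (phi1 - psi1).
  have := addr_ge0 h1 h2; set z := _ + _; suff -> : z = d ^+ 2 * (phi1 - psi1) by [].
  by rewrite /z; ring.
by rewrite pmulr_rge0 ?subr_ge0// exprn_even_gt0.
Unshelve. all: by end_near. Qed.

(** * The barrier, its pieces, and the compact annulus carrying it *)

Lemma is_derive_expR_affine (R : realType) (C a k s : R) :
  is_derive s 1 (fun s : R => C * expR (a + k * s)) (C * k * expR (a + k * s)).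
Proof.
have d : is_derive s (1 : R) (fun s : R => a + k * s) k.
  apply/is_derive1_caratheodory; exists (cst k); split=> //; last exact: cvg_cst.
  by move=> z /=; ring.
have d1 := @is_derive1_comp R expR (fun s => a + k * s) s _ _
  (is_derive_expR _) d.
have d2 := is_deriveZ C d1.
by apply: is_derive_eq d2 _; rewrite /GRing.scale/=; ring.
Qed.

Lemma is_derive_gauss (R : realType) (C k p s : R) :
  is_derive s 1 (fun s : R => C * expR (- (k / 2) * (s - p) ^+ 2))
    (- (k * (s - p)) * (C * expR (- (k / 2) * (s - p) ^+ 2))).
Proof.
have d : is_derive s (1 : R) (fun s : R => - (k / 2) * (s - p) ^+ 2)
    (- (k * (s - p))).
  apply/is_derive1_caratheodory.
  exists (fun z => - (k / 2) * (z + (s - 2 * p))); split.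
  - by move=> z /=; ring.
  - apply: cvgM; first exact: cvg_cst.
    by apply: cvgD; [exact: cvg_id|exact: cvg_cst].
  - by field.
have d1 := @is_derive1_comp R expR (fun s => - (k / 2) * (s - p) ^+ 2) s _ _
  (is_derive_expR _) d.
have d2 := is_deriveZ C d1.
apply: is_derive_eq d2 _.
by rewrite /GRing.scale/=; ring.
Qed.

Lemma is_derive_gauss2 (R : realType) (C k p s : R) :
  is_derive s 1
    (fun s : R => - (k * (s - p)) * (C * expR (- (k / 2) * (s - p) ^+ 2)))
    (((k * (s - p)) ^+ 2 - k) * (C * expR (- (k / 2) * (s - p) ^+ 2))).
Proof.
have d : is_derive s (1 : R) (fun s : R => - (k * (s - p))) (- k).
  apply/is_derive1_caratheodory; exists (cst (- k)); split=> //; last exact: cvg_cst.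
  by move=> z /=; ring.
have d2 := is_deriveM d (is_derive_gauss C k p s).
apply: is_derive_eq d2 _.
by rewrite /GRing.scale/=; ring.
Qed.

(** Boundedness refers to the sup norm, which the Euclidean norm dominates. *)
Lemma compact_annulus (R : realType) (N : nat) (r1 r2 : R) :
  compact [set x : 'rV[R]_N | r1 <= enorm x <= r2].
Proof.
apply: bounded_closed_compact.
  exists r2; split; first exact: num_real.
  move=> M r2M x /= /andP[_ xr2].
  have M0 : 0 <= M by rewrite (le_trans _ (ltW r2M))// (le_trans _ xr2)// enorm_ge0.
  rewrite [leLHS]/Num.norm/= mx_normrE; apply/bigmax_leP; split=> // -[i j] _ /=.
  rewrite (le_trans _ (ltW r2M))// (le_trans _ xr2)// ord1.
  rewrite -(@ler_pXn2r _ 2) ?nnegrE ?enorm_ge0// sqr_enorm real_normK ?num_real//.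
  by rewrite (bigD1 j)//= lerDl sumr_ge0// => *; exact: sqr_ge0.
have -> : [set x : 'rV[R]_N | r1 <= enorm x <= r2] =
    @enorm R N @^-1` [set y | r1 <= y] `&` @enorm R N @^-1` [set y | y <= r2].
  by apply/seteqP; split=> [x /andP[]|x /= [-> ->]].
apply: closedI; (apply: preimage_closed => [x _|]; first exact: continuous_enorm).
- exact: closed_ge.
- exact: closed_le.
Qed.

(** The argument [s] is measured from the centre. The minimum freezes the Gaussian outside
    [|s| <= h] and the maximum freezes the exponential factor inside, so a single formula covers all
    pieces and is visibly continuous. *)
Definition barrier (R : realType) (kappa k h s : R) : R :=
  expR (- (kappa / 2) * Num.min `|s| h ^+ 2) *
  (expR (k * (h + ln 2 - Num.max `|s| h)) - 1).

Lemma continuous_barrier (R : realType) (kappa k h : R) :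
  continuous (barrier kappa k h).
Proof.
move=> s.
have cmin : {for s, continuous (fun s : R => Num.min `|s| h)}.
  by apply: continuous_min; [exact: norm_continuous|exact: cst_continuous].
have cmax : {for s, continuous (fun s : R => Num.max `|s| h)}.
  by apply: continuous_max; [exact: norm_continuous|exact: cst_continuous].
apply: cvgM.
  apply: continuous_cvg; first exact: continuous_expR.
  apply: cvgM; first exact: cvg_cst.
  exact: (cvgM cmin cmin).
apply: cvgB; last exact: cvg_cst.
apply: continuous_cvg; first exact: continuous_expR.
apply: cvgM; first exact: cvg_cst.
by apply: cvgB; [exact: cvg_cst|exact: cmax].
Qed.

Lemma barrier_inner (R : realType) (kappa k h s : R) : `|s| <= h ->
  barrier kappa k h s =
  (expR (k * ln 2) - 1) * expR (- (kappa / 2) * s ^+ 2).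
Proof.
move=> sh; rewrite /barrier min_l// max_r// real_normK ?num_real//.
by rewrite addrAC subrr add0r [LHS]mulrC.
Qed.

Lemma barrier_right (R : realType) (kappa k h s : R) : 0 < h -> h <= s ->
  barrier kappa k h s = expR (- (kappa / 2) * h ^+ 2) *
    expR (k * (h + ln 2) + - k * s) - expR (- (kappa / 2) * h ^+ 2).
Proof.
move=> h0 hs; rewrite /barrier ger0_norm ?(le_trans (ltW h0))//.
by rewrite min_r// max_l// (mulrBr k) -(mulNr k) mulrBr mulr1.
Qed.

Lemma barrier_left (R : realType) (kappa k h s : R) : 0 < h -> s <= - h ->
  barrier kappa k h s = expR (- (kappa / 2) * h ^+ 2) *
    expR (k * (h + ln 2) + k * s) - expR (- (kappa / 2) * h ^+ 2).
Proof.
move=> h0 hs; have := @barrier_right R kappa k h (- s) h0.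
by rewrite lerNr mulrNN => <- //; rewrite /barrier normrN.
Qed.

(** This keeps the maximum point of barrier over [u] off the boundary of the annulus. *)
Lemma barrier_gt0 (R : realType) (kappa k h s : R) : 0 < k ->
  0 < barrier kappa k h s -> `|s| < h + ln 2.
Proof.
move=> k0; rewrite pmulr_rgt0 ?expR_gt0// subr_gt0 expR_gt1 pmulr_rgt0// subr_gt0.
by rewrite gt_max => /andP[].
Qed.

(* The kink of [barrier] at [|s| = h] is convex: with [kappa * h = k + 2] its
   slope is steeper on the inside than on the outside. *)
Lemma barrier_slope (R : realType) (k : R) : 0 < k ->
  k * expR (k * ln 2) < (k + 2) * (expR (k * ln 2) - 1).
Proof.
move=> k0.
(* With [e = expR (k * ln 2)] the claim reads [2 e > k + 2], which follows from [e > 1 + k ln 2] and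
   [ln 2 >= 1/2]. *)
have ln2 : 1 / 2 <= ln 2 :> R.
  have := @le_ln1Dx R (- (1 / 2)); rewrite (_ : 1 + _ = 2^-1); last by field.
  by rewrite lnV ?posrE//; lra.
have := @expR_gt1Dx R (k * ln 2); rewrite mulf_neq0 ?gt_eqF//; last by lra.
move=> /(_ isT); move: (expR _) => e; nra.
Qed.

(** * Nonexistence from bounds on one annulus *)

(** Real bounds [D] and [I0] replace the supremum and infimum, so that both halves of the theorem
    reduce to a choice of annulus. *)
Lemma no_supersolution_annulus (R : realType) (N : nat)
    (R0 r gamma D I0 : R) (b c u : 'rV[R]_N -> R) :
  (3 <= N)%N -> 0 < R0 -> 2 * R0 < r -> 1 < gamma -> 1 <= D ->
  (forall x, exterior R0 x -> 0 <= c x) ->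
  (forall x, annulus r (gamma * r) x -> I0 <= scaled_potential b c x) ->
  (forall x, annulus (r / 2) (2 * gamma * r) x -> drift_weight b x <= D) ->
  let beta : R := (N%:R - 2) / 2 in
  ((beta ^+ 2 * ln 2 + 4 * beta + 6) / ln gamma + beta ^+ 2) * D < I0 ->
  ~ positive_supersolution (exterior R0) b c u.
Proof.
move=> N3 R00 r2R0 g1 D1 c0 hI hD beta hbeta usup.
have [[[ucont udrv _] _] u0 _] := usup.
have N0 : (0 < N)%N by case: N N3 {b c u c0 hI hD beta hbeta usup ucont udrv u0}.
have NR : (3 : R) <= N%:R by rewrite ler_nat.
have D0 : 0 < D by lra.
have D10 : 0 <= D - 1 by rewrite subr_ge0.
have N2E : N%:R - 2 = 2 * beta by rewrite /beta; field.
have beta0 : 0 < beta by rewrite /beta; lra.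
have beta20 : 0 < 2 * beta by lra.
have r0 : 0 < r by lra.
have g0 : 0 < gamma by lra.
have lng : 0 < ln gamma by rewrite ln_gt0.
have ln20 : 0 < ln 2 :> R by rewrite ln_gt0// ltr1n.
pose h := ln gamma / 2; have h0 : 0 < h by rewrite divr_gt0.
pose p := ln r + h.
(* On the outer pieces [k] must exceed [|x| |b| + 2 beta], which is at most [beta (D - 1) + 2 beta];
   it does so by at least 1. *)
pose k := beta * (D + 1) + 1.
have k0 : 0 < k by rewrite ltr_wpDl// mulr_ge0// ltW// addr_gt0.
pose kappa := (k + 2) / h.
have kappah : kappa * h = k + 2 by rewrite /kappa divfK// gt_eqF.
(* As [D >= 1], one has [2 (k + 2) = 2 beta (D + 1) + 6 <= (4 beta + 6) D], and
   [kappa = 2 (k + 2) / ln gamma]. *)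
have hkappa : kappa + beta ^+ 2 * D < I0.
  apply: le_lt_trans hbeta; rewrite mulrDl lerD2r mulrAC.
  rewrite /kappa /h invf_div mulrA ler_pdivrMr// divfK ?gt_eqF// /k.
  have : 0 <= beta ^+ 2 * ln 2 * D.
    by rewrite mulr_ge0 ?(ltW D0)// mulr_ge0 ?sqr_ge0// ltW.
  have : 0 <= beta * (D - 1) by rewrite mulr_ge0// ltW.
  lra.
have lnr1 : ln (r / 2) = p - (h + ln 2).
  by rewrite ln_div ?posrE// /p; ring.
have lnr2 : ln (2 * gamma * r) = p + (h + ln 2).
  by rewrite !lnM ?posrE ?mulr_gt0// /p /h; field.
have lngr : ln (gamma * r) = p + h.
  by rewrite !lnM ?posrE ?mulr_gt0// /p /h; field.
pose V (s : R) := barrier kappa k h (s - p).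
pose K := [set x : 'rV[R]_N | r / 2 <= enorm x <= 2 * gamma * r].
have K_ext x : K x -> exterior R0 x.
  by move=> /andP[rx _]; rewrite /exterior/= (lt_le_trans _ rx)//; lra.
have ext_gt0 (x : 'rV[R]_N) : exterior R0 x -> 0 < enorm x by move=> /(lt_trans R00).
have KP (x : 'rV[R]_N) : 0 < enorm x -> `|ln (enorm x) - p| < h + ln 2 ->
    annulus (r / 2) (2 * gamma * r) x.
  move=> x0; rewrite ltr_distl -lnr1 -lnr2.
  by rewrite !ltr_ln ?posrE ?mulr_gt0 ?invr_gt0.
have annulus_K x : annulus (r / 2) (2 * gamma * r) x -> K x.
  by move=> /andP[/ltW ? /ltW ?]; apply/andP.
(* A point with [|s - p| = h], where the barrier is positive; it makes the maximal ratio
   positive. *)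
pose x1 : 'rV[R]_N := (gamma * r) *: delta_mx ord0 (Ordinal N0).
have x1E : enorm x1 = gamma * r by rewrite enorm0_line// mulr_ge0 ?ltW.
have Kx1 : K x1.
  by rewrite /K/= x1E; apply/andP; split; nra.
have Vx1 : 0 < V (ln (enorm x1)).
  rewrite /V x1E lngr (addrC p) addrK barrier_inner ?gtr0_norm//.
  by rewrite mulr_gt0 ?expR_gt0// subr_gt0 expR_gt1 mulr_gt0.
have [x0 /set_mem Kx0 x0max] : exists2 x0, x0 \in K & forall x, x \in K ->
    V (ln (enorm x)) / u x <= V (ln (enorm x0)) / u x0.
  apply: EVT_max_rV; [by exists x1|exact: compact_annulus|].
  apply: continuous_in_subspaceT => x /set_mem/K_ext xR.
  have cln : {for x, continuous (fun y : 'rV[R]_N => ln (enorm y) - p)}.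
    have cln' : {for x, continuous (fun y : 'rV[R]_N => ln (enorm y))}.
      apply: continuous_comp; first exact: continuous_enorm.
      exact/continuous_ln/ext_gt0.
    exact: (continuousB cln' (@cst_continuous _ _ p x)).
  have cV : {for x, continuous (fun y : 'rV[R]_N => V (ln (enorm y)))}.
    exact: (@continuous_comp _ _ _ _ (barrier kappa k h) x cln
      (@continuous_barrier _ _ _ _ _)).
  have cu : {for x, continuous u}.
    move: ucont; rewrite (continuous_open_subspace u (@open_exterior R N R0)).
    by apply; rewrite inE.
  by apply: (cvgM cV); apply: cvgV => //; rewrite gt_eqF// u0.
(* With this maximal ratio, [V <= m * u] on [K] with equality at [x0]. *)
pose m := V (ln (enorm x0)) / u x0.
have m0 : 0 < m.
  by rewrite (lt_le_trans _ (x0max x1 (mem_set Kx1)))// divr_gt0// u0//; exact: K_ext.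
have ux0 : 0 < u x0 by apply/u0/K_ext.
have VE : V (ln (enorm x0)) = m * u x0 by rewrite /m divfK// gt_eqF.
have V_le x : K x -> V (ln (enorm x)) <= m * u x.
  move=> Kx; rewrite -ler_pdivrMr; first exact/x0max/mem_set.
  exact/u0/K_ext.
have ex0 := K_ext _ Kx0; have nx0 := ext_gt0 _ ex0.
have sx0 : `|ln (enorm x0) - p| < h + ln 2.
  by apply: (barrier_gt0 (kappa := kappa) k0); rewrite -/(V _) VE mulr_gt0.
set s0 := ln (enorm x0) in VE sx0.
(* The interval from [a] to [a'] singles out the barrier piece or pieces met near [x0], while the
   comparison with [m * u] persists. *)
have near_le (e : 'rV[R]_N) a a' :
    a < s0 < a' -> p - (h + ln 2) <= a -> a' <= p + (h + ln 2) ->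
    \forall t \near (0 : R), a < ln (enorm (x0 + t *: e)) < a' /\
      V (ln (enorm (x0 + t *: e))) <= m * u (x0 + t *: e).
  move=> as0 pa a'p; apply: filterS2 (near_line e nx0 as0) (near_line_exterior e ex0).
  move=> t /andP[al la'] ext; split; first by rewrite al.
  apply/V_le/annulus_K/KP; first exact: ext_gt0.
  rewrite ltr_distl; lra.
have hB : enorm x0 * `|b x0| <= beta * (D - 1).
  have := hD x0 (KP _ nx0 sx0); rewrite /drift_weight N2E.
  rewrite -lerBrDl ler_pdivrMr//; move: (enorm x0) (`|b x0|) => *.
  lra.
pose Ck := expR (k * ln 2) - 1.
have Ck0 : 0 < Ck by rewrite subr_gt0 expR_gt1 mulr_gt0.
pose Ch := expR (- (kappa / 2) * h ^+ 2).
have Ch0 : 0 < Ch := expR_gt0 _.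
(* Both outer pieces at once, with [l = - k] on the right and [l = k] on the left. After division by
   [Ch * E] the right-hand side is at most [k (|x| |b| - k + 2 beta) < 0], whereas the left-hand
   side is nonnegative because [c >= 0]. *)
have outer a l : `|l| = k -> Ch * expR (a + l * s0) - Ch = m * u x0 ->
    ~ (forall i : 'I_N, \forall t \near (0 : R),
      Ch * expR (a + l * ln (enorm (x0 + t *: delta_mx ord0 i))) - Ch <=
      m * u (x0 + t *: delta_mx ord0 i)).
  move=> lk eq0 le0.
  have dphi s : is_derive s (1 : R) (fun s : R => Ch * expR (a + l * s) - Ch)
      (Ch * l * expR (a + l * s)).
    have d := is_deriveB (is_derive_expR_affine Ch a l s)
      (is_derive_cst Ch s (1 : R)).
    by apply: is_derive_eq d _; rewrite subr0.
  have := supersolution_touching usup ex0 nx0 m0 dphi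
    (is_derive_expR_affine (Ch * l) a l) le0 eq0.
  rewrite -/s0 eq0 N2E leNgt => /negP; apply.
  apply: lt_le_trans (_ : 0 <= _); last first.
    by rewrite mulr_ge0 ?(ltW (mulr_gt0 m0 ux0))// mulr_ge0 ?c0 ?sqr_ge0.
  rewrite !normrM lk (gtr0_norm Ch0) (gtr0_norm (expR_gt0 _)).
  rewrite -[Ch * l * l]mulrA -expr2 -(real_normK (num_real l)) lk.
  have E0 := expR_gt0 (a + l * s0); move: (expR _) E0 => E E0.
  have : - l <= k by rewrite -lk ler_normr lexx orbT.
  have CE0 : 0 < Ch * E by rewrite mulr_gt0.
  move=> lk'.
  have : Ch * E * (enorm x0 * `|b x0| * k - k ^+ 2 - 2 * beta * l) < 0.
    rewrite pmulr_rlt0//.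
    have : (enorm x0 * `|b x0| - k + 2 * beta) * k < 0.
      rewrite pmulr_llt0//. move: hB; rewrite /k; move: (_ * `|b x0|) => B.
      lra.
    have : 2 * beta * (- l) <= 2 * beta * k by rewrite ler_pM2l.
    move: (enorm x0 * `|b x0|) => *; lra.
  move: (enorm x0 * `|b x0|) => *; lra.
pose phiR s := Ch * expR (k * (h + ln 2 + p) + - k * s) - Ch.
pose phiL s := Ch * expR (k * (h + ln 2 - p) + k * s) - Ch.
pose phiG s := Ck * expR (- (kappa / 2) * (s - p) ^+ 2).
have VR s : p + h <= s -> V s = phiR s.
  rewrite addrC -lerBrDr => ?; rewrite /V barrier_right//.
  by congr (_ * expR _ - _); ring.
have VL s : s <= p - h -> V s = phiL s.
  rewrite addrC -lerBlDr => ?; rewrite /V barrier_left//.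
  by congr (_ * expR _ - _); ring.
have VG s : p - h <= s <= p + h -> V s = phiG s.
  by rewrite -ler_distl => ?; rewrite /V barrier_inner.
have ln2p : p - (h + ln 2) <= p - h by rewrite lerD2l lerN2 lerDl ltW.
have ln2p' : p + h <= p + (h + ln 2) by rewrite lerD2l lerDl ltW.
have ph : p - h < p + h by lra.
have /andP[lo hi] : p - (h + ln 2) < s0 < p + (h + ln 2) by rewrite -ltr_distl.
have slope := barrier_slope k0.
(* The positions of [s0] are taken in the order: beyond the outer kink, at it, inside the inner
   kink, strictly between the kinks, at the inner kink. *)
case: (ltrgtP s0 (p + h)) => [s0R|s0R|s0R]; last 2 first.
- apply: (outer (k * (h + ln 2 + p)) (- k)); rewrite ?normrN ?gtr0_norm//.
    by rewrite -VE VR// ltW.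
  move=> i; have I0R : p + h < s0 < p + (h + ln 2) by rewrite s0R.
  have := near_le (delta_mx ord0 i) _ _ I0R; rewrite lexx => H.
  apply: filterS (H _ isT) => [t [/andP[st _]]|]; last by lra.
  by rewrite VR// ltW.
- have IR : p - h < s0 < p + (h + ln 2) by rewrite hi s0R ph.
  have dR : is_derive s0 (1 : R) phiR _ := is_deriveB
    (is_derive_expR_affine Ch (k * (h + ln 2 + p)) (- k) s0)
    (is_derive_cst Ch s0 (1 : R)).
  have phiGE : phiG s0 = m * u x0 by rewrite -VE VG// s0R lexx andbT ltW.
  have phiRE : phiR s0 = m * u x0 by rewrite -VE VR// s0R.
  have := radial_kink nx0 (fun i => udrv i x0 ex0) (is_derive_gauss Ck kappa p s0)
    dR phiGE phiRE.
  have le_phi (i : 'I_N) : \forall t \near (0 : R),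
     (ln (enorm (x0 + t *: delta_mx ord0 i)) < s0 ->
       phiG (ln (enorm (x0 + t *: delta_mx ord0 i))) <=
         m * u (x0 + t *: delta_mx ord0 i)) /\
     (s0 < ln (enorm (x0 + t *: delta_mx ord0 i)) ->
       phiR (ln (enorm (x0 + t *: delta_mx ord0 i))) <=
         m * u (x0 + t *: delta_mx ord0 i)).
    apply: filterS (near_le (delta_mx ord0 i) _ _ IR ln2p (lexx _)).
    move=> t [/andP[ts st] Vt]; split => ls; first by rewrite -VG// ltW//= -s0R ltW.
    by rewrite -VR// -s0R ltW.
  move=> /(_ le_phi); rewrite subr0.
  rewrite (_ : k * (h + ln 2 + p) + - k * s0 = k * ln 2); last by rewrite s0R; ring.
  rewrite (_ : s0 - p = h); last by rewrite s0R; ring.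
  (* The slopes at the kink are [- (k + 2) Ck Ch] inside and [- k (Ck + 1) Ch] outside; their order
     contradicts [slope]. *)
  by rewrite kappah -/Ch; move: slope; rewrite -/Ck -(ltr_pM2l Ch0); lra.
case: (ltrgtP s0 (p - h)) => [s0L|s0L|s0L].
- apply: (outer (k * (h + ln 2 - p)) k); rewrite ?gtr0_norm//.
    by rewrite -VE VL// ltW.
  move=> i; have I0L : p - (h + ln 2) < s0 < p - h by rewrite lo.
  have := near_le (delta_mx ord0 i) _ _ I0L; rewrite lexx => /(_ isT) H.
  apply: filterS (H _) => [t [/andP[_ st]]|]; last by lra.
  by rewrite VL// ltW.
- have I0G : p - h < s0 < p + h by rewrite s0L.
  have le_phiG (i : 'I_N) : \forall t \near (0 : R),
      phiG (ln (enorm (x0 + t *: delta_mx ord0 i))) <=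
      m * u (x0 + t *: delta_mx ord0 i).
    apply: filterS (near_le (delta_mx ord0 i) _ _ I0G ln2p ln2p').
    by move=> t [/andP[ts st]]; rewrite VG// !ltW.
  have phiGE : phiG s0 = m * u x0 by rewrite -VE VG// !ltW.
  have phiG0 : 0 < phiG s0 by rewrite phiGE mulr_gt0.
  have := supersolution_touching usup ex0 nx0 m0 (is_derive_gauss Ck kappa p)
    (is_derive_gauss2 Ck kappa p) le_phiG phiGE.
  rewrite -/s0 -/(phiG s0) N2E normrM normrN (gtr0_norm phiG0).
  set w := kappa * (s0 - p).
  have ann : annulus r (gamma * r) x0.
    rewrite /annulus/= -ltr_ln ?posrE// -[in X in _ && X]ltr_ln ?posrE ?mulr_gt0//.
    by rewrite lngr -/s0 s0R andbT (_ : ln r = p - h)// /p addrK.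
  have := hI x0 ann; rewrite /scaled_potential => hI0.
  have -> : enorm x0 * `|b x0| * (`|w| * phiG s0) -
    ((w ^+ 2 - kappa) * phiG s0 + 2 * beta * (- w * phiG s0)) =
    (enorm x0 * `|b x0| * `|w| - w ^+ 2 + kappa + 2 * beta * w) * phiG s0 by ring.
  rewrite ler_pM2r// => hc.
  have w2 : `|w| ^+ 2 = w ^+ 2 by rewrite real_normK ?num_real.
  have wle : 2 * beta * w <= 2 * beta * `|w| by rewrite ler_pM2l// ler_norm.
  have b2 : `|b x0| ^+ 2 = b x0 ^+ 2 by rewrite real_normK ?num_real.
  (* Completing the square in [|w|] gives [|x|^2 c <= kappa + (|x| |b| / 2 + beta)^2]. Expanding and
     using [hB] yields [|x|^2 (c - b^2/4) <= kappa + beta^2 D < I0]. *)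
  have sq := sqr_ge0 (`|w| - enorm x0 * `|b x0| / 2 - beta).
  have bB : beta * (enorm x0 * `|b x0|) <= beta * (beta * (D - 1)) by rewrite ler_pM2l.
  move: hI0 hc sq bB hkappa; rewrite -b2 -w2.
  move: (enorm x0) (`|b x0|) (`|w|) wle (c x0) => rho B W wle C *.
  lra.
- have IL : p - (h + ln 2) < s0 < p + h by rewrite lo s0L ph.
  have dL : is_derive s0 (1 : R) phiL _ := is_deriveB
    (is_derive_expR_affine Ch (k * (h + ln 2 - p)) k s0)
    (is_derive_cst Ch s0 (1 : R)).
  have phiGE : phiG s0 = m * u x0 by rewrite -VE VG// s0L lexx ltW.
  have phiLE : phiL s0 = m * u x0 by rewrite -VE VL// s0L.
  have := radial_kink nx0 (fun i => udrv i x0 ex0) dL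
    (is_derive_gauss Ck kappa p s0) phiLE phiGE.
  have le_phi (i : 'I_N) : \forall t \near (0 : R),
     (ln (enorm (x0 + t *: delta_mx ord0 i)) < s0 ->
       phiL (ln (enorm (x0 + t *: delta_mx ord0 i))) <=
         m * u (x0 + t *: delta_mx ord0 i)) /\
     (s0 < ln (enorm (x0 + t *: delta_mx ord0 i)) ->
       phiG (ln (enorm (x0 + t *: delta_mx ord0 i))) <=
         m * u (x0 + t *: delta_mx ord0 i)).
    apply: filterS (near_le (delta_mx ord0 i) _ _ IL (lexx _) ln2p').
    move=> t [/andP[ts st] Vt]; split => ls; first by rewrite -VL// -s0L ltW.
    by rewrite -VG// -s0L !ltW.
  move=> /(_ le_phi); rewrite subr0.
  rewrite (_ : k * (h + ln 2 - p) + k * s0 = k * ln 2); last by rewrite s0L; ring.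
  rewrite (_ : s0 - p = - h); last by rewrite s0L; ring.
  by rewrite sqrrN mulrN kappah -/Ch; move: slope; rewrite -/Ck -(ltr_pM2l Ch0); lra.
Qed.

(** * From extended-real quotients to real bounds *)

Lemma drift_weight_ge1 (R : realType) (N : nat) (b : 'rV[R]_N -> R)
    (x : 'rV[R]_N) : (2 <= N)%N -> 1 <= drift_weight b x.
Proof.
move=> N2; rewrite lerDl divr_ge0 ?subr_ge0 ?ler_nat//.
by rewrite !mulr_ge0// enorm_ge0.
Qed.

(** An infinite denominator makes the quotient 0, which is not above [k >= 0]. An infinite numerator
    is replaced by the finite bound [k * D + 1]. *)
Lemma lt_ediv_real (R : realType) (k : R) (x y : \bar R) :
  0 <= k -> (1 <= y)%E -> (k%:E < x / y)%E ->
  exists D I0 : R, [/\ y = D%:E, 1 <= D, k * D < I0 & (I0%:E <= x)%E].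
Proof.
move=> k0; case: y => [D| |//]; last first.
  by rewrite invey mule0 lte_fin ltNge k0.
rewrite lee_fin => D1; have D0 : 0 < D by rewrite (lt_le_trans _ D1).
rewrite inver gt_eqF// lte_pdivlMr// -EFinM => kDx; exists D.
case: x kDx => [I0|_|//]; first by rewrite lte_fin; exists I0.
by exists (k * D + 1); rewrite ltrDl leey.
Qed.

Theorem theorem1 (R : realType) (N : nat) (R0 : R) (b c : 'rV[R]_N -> R)
    (hN : (3 <= N)%N) (hR0 : 0 < R0)
    (b_cont : {within exterior R0, continuous b})
    (c_cont : {within exterior R0, continuous c})
    (c_ge0 : forall x, exterior R0 x -> 0 <= c x)
    (bc_pos : \forall x \near at_infinity R N, 0 < c x - b x ^+ 2 / 4) :
  let beta : R := (N%:R - 2) / 2 in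
  (forall gamma : R, 1 < gamma ->
    (((beta ^+ 2 * ln 2 + 4 * beta + 6) / ln gamma + beta ^+ 2)%:E <
     ereal_sup [set (ereal_inf [set (scaled_potential b c x)%:E
                                 | x in annulus r (gamma * r)%R] /
                     ereal_sup [set (drift_weight b x)%:E
                                 | x in annulus (r / 2)%R (2 * gamma * r)%R])
               | r in [set r : R | (2 * R0 < r)%R]])%E ->
    ~ exists u : 'rV[R]_N -> R, positive_supersolution (exterior R0) b c u)
  /\
  ((limf_esup (fun x => (drift_weight b x)%:E) (at_infinity R N) < +oo)%E ->
   (((N%:R - 2) ^+ 2 / 4)%:E <
     limf_einf (fun x => (scaled_potential b c x)%:E) (at_infinity R N) /
     limf_esup (fun x => (drift_weight b x)%:E) (at_infinity R N))%E ->
   ~ exists u : 'rV[R]_N -> R, positive_supersolution (exterior R0) b c u).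
Proof.
move=> beta.
have N0 : (0 < N)%N by case: N hN {b c b_cont c_cont c_ge0 bc_pos beta}.
have NR : (3 : R) <= N%:R by rewrite ler_nat.
have beta0 : 0 < beta by rewrite /beta; lra.
have ln20 : 0 < ln 2 :> R by rewrite ln_gt0// ltr1n.
pose Q := beta ^+ 2 * ln 2 + 4 * beta + 6.
have Q0 : 0 < Q.
  have : 0 <= beta ^+ 2 * ln 2 by rewrite mulr_ge0 ?sqr_ge0// ltW.
  by rewrite /Q; lra.
(* Points of prescribed norm show that the annuli and the neighbourhoods of infinity are inhabited,
   so the suprema are at least 1. *)
pose pt (t : R) : 'rV[R]_N := t *: delta_mx ord0 (Ordinal N0).
have ptE t : 0 <= t -> enorm (pt t) = t by move=> ?; rewrite enorm0_line.
split=> [gamma g1 /ereal_sup_gt[_ [r /= r2R0 <-]]|_].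
  have lng : 0 < ln gamma by rewrite ln_gt0.
  have K0 : 0 <= Q / ln gamma + beta ^+ 2.
    by apply: addr_ge0; [apply: divr_ge0; exact: ltW|exact: sqr_ge0].
  set S := ereal_sup _; have S1 : (1 <= S)%E.
    apply: le_ereal_sup_tmp; exists (drift_weight b (pt r))%:E.
      exists (pt r) => //; rewrite /annulus/= ptE; last by lra.
      by apply/andP; split; nra.
    by rewrite lee_fin drift_weight_ge1// ltnW.
  move=> /(lt_ediv_real K0 S1)[D [I0 [DE D1 hI hI']]] [u usup].
  apply: (@no_supersolution_annulus R N R0 r gamma D I0 b c u) => //.
  - move=> x xr; rewrite -lee_fin (le_trans hI')//.
    by apply: ereal_inf_lbound; exists x.
  - move=> x xr; rewrite -lee_fin -DE.
    by apply: ereal_sup_ubound; exists x.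
have -> : (N%:R - 2) ^+ 2 / 4 = beta ^+ 2 by rewrite /beta; field.
set S := limf_esup _ _; have S1 : (1 <= S)%E.
  apply: le_ereal_inf_tmp => _ [V [rho _ rhoV] <-].
  have := normr_ge0 rho; have := ler_norm rho => rho_le rho_ge0.
  apply: le_ereal_sup_tmp; exists (drift_weight b (pt (`|rho| + 1)))%:E.
    by exists (pt (`|rho| + 1)) => //; apply: rhoV; rewrite /exterior/= ptE; lra.
  by rewrite lee_fin drift_weight_ge1// ltnW.
move=> /(lt_ediv_real (sqr_ge0 beta) S1)[D [I0 [DE D1 hI hI']]] [u usup].
(* The limits give eventual bounds only after a strict loss. Moving [D] and [I0] by [e] costs
   [(beta ^+ 2 + 1) * e], half of the available gap. *)
have [D' [I' [DD' II' hI2]]] : exists D' I' : R,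
    [/\ D < D', I' < I0 & beta ^+ 2 * D' < I'].
  pose e := (I0 - beta ^+ 2 * D) / (2 * (beta ^+ 2 + 1)).
  have b20 : 0 < beta ^+ 2 + 1 by rewrite ltr_wpDl ?sqr_ge0.
  have e0 : 0 < e by rewrite divr_gt0 ?subr_gt0// mulr_gt0.
  have eE : 2 * (beta ^+ 2 + 1) * e = I0 - beta ^+ 2 * D.
    by rewrite mulrC divfK// gt_eqF// mulr_gt0.
  have be0 : 0 < (beta ^+ 2 + 1) * e by rewrite mulr_gt0.
  exists (D + e), (I0 - e); split; last by move: (beta ^+ 2) eE be0 => *; lra.
    by rewrite ltrDl.
  by rewrite ltrBlDr ltrDl.
have [r1 hr1] : exists r1, forall x, exterior r1 x -> drift_weight b x <= D'.
  have : (S < D'%:E)%E by rewrite DE lte_fin.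
  move=> /ereal_inf_lt[_ [V [r1 _ r1V] <-] supV]; exists r1 => x /r1V Vx.
  rewrite -lee_fin (le_trans _ (ltW supV))//.
  by apply: ereal_sup_ubound; exists x.
have [r2 hr2] : exists r2, forall x, exterior r2 x -> I' <= scaled_potential b c x.
  have : (I'%:E < limf_einf (fun x => (scaled_potential b c x)%:E) (at_infinity R N))%E.
    by rewrite (lt_le_trans _ hI')// lte_fin.
  rewrite limf_einfE => /ereal_sup_gt[_ [V [r2 _ r2V] <-] infV].
  exists r2 => x /r2V Vx; rewrite -lee_fin (le_trans (ltW infV))//.
  by apply: ereal_inf_lbound; exists x.
(* Here [t] is [ln gamma], taken large enough that [Q * D' / t] fits into the gap
   [I' - beta ^+ 2 * D']. *)
pose t := Q * D' / (I' - beta ^+ 2 * D') + 1.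
have D'0 : 0 < D' by lra.
have gap0 : 0 < I' - beta ^+ 2 * D' by rewrite subr_gt0.
have t0 : 0 < t by rewrite ltr_wpDl// divr_ge0 ?mulr_ge0 ?ltW.
(* Then [r / 2] exceeds both [r1] and [r2], so both eventual bounds hold on the annuli. *)
pose r := 2 * (`|r1| + `|r2| + R0) + 1.
have g1 : 1 < expR t by rewrite expR_gt1.
have := ler_norm r1; have := ler_norm r2.
have := normr_ge0 r1; have := normr_ge0 r2 => n1 n2 n3 n4.
apply: (@no_supersolution_annulus R N R0 r (expR t) D' I' b c u) => //.
- by rewrite /r; lra.
- by lra.
- by move=> x /andP[xr _]; apply: hr2; rewrite /exterior/= (lt_trans _ xr)// /r; lra.
- by move=> x /andP[xr _]; apply: hr1; rewrite /exterior/= (lt_trans _ xr)// /r; lra.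
rewrite -/beta -/Q expRK mulrDl -ltrBrDr mulrAC ltr_pdivrMr//.
by rewrite -ltr_pdivrMl// [ltLHS]mulrC ltrDl.
Qed.
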